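(* Let $0<p<\infty$, let $(u,\sigma)$ be a pair of weights on $\mathbb{R}^n$, and let $\mathcal{B}$ be a basis in $\mathbb{R}^n$ such that the maximal operator $M^{\mathcal{B}}$ is bounded on $L^s(\mathbb{R}^n)$ for all $1<s<\infty$. If $u$ satisfies condition $\mathsf{A}$ (with respect to $\mathcal{B}$) and there exist $r$ with $0<r<1$ and a constant $C$ such that $$\frac{1}{|B|}\int_B u\,dx\le C\left(\frac{1}{|B|}\int_B\sigma^r\,dx\right)^{\frac{p+1}{r}}\qquad\text{for all } B\in\mathcal{B},$$ then there is a constant $C'$ such that $$\int_{\mathbb{R}^n}\big(M^{\mathcal{B}}_{-1}(f\sigma^{-1})\big)^p\,u\,dx\le C'\int_{\mathbb{R}^n}|f|^p\,\sigma\,dx$$ for all $f\in L^p(\sigma)$.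
   Context: A basis $\mathcal{B}$ is a collection of bounded open sets in $\mathbb{R}^n$. A weight is a non-negative locally integrable function on $\mathbb{R}^n$; for a weight $w$ and measurable $E$, $w(E)=\int_E w\,dx$, and $L^p(w)$ is the space of measurable $f$ with $\int_{\mathbb{R}^n}|f|^p w\,dx<\infty$. $\mathbf{1}_E$ denotes the characteristic function of $E$. The Hardy-Littlewood maximal operator and the harmonic maximal operator with respect to $\mathcal{B}$ are $$M^{\mathcal{B}}f(x)=\sup_{B\in\mathcal{B},\,x\in B}\frac{1}{|B|}\int_B|f|\,dx,\qquad M^{\mathcal{B}}_{-1}f(x)=\sup_{B\in\mathcal{B},\,x\in B}\left(\frac{1}{|B|}\int_B|f|^{-1}\,dx\right)^{-1},$$ with the conventions $1/0=\infty$, $1/\infty=0$, $0\cdot\infty=0$, and both operators taking the value $0$ at $x\notin\bigcup_{B\in\mathcal{B}}B$. A weight $w$ satisfies condition $\mathsf{A}$ (with respect to $\mathcal{B}$) if there exist constants $0<\alpha<1$ and $c=c(\alpha)$ such that $$w(\{x\in\mathbb{R}^n: M^{\mathcal{B}}(\mathbf{1}_E)(x)>\alpha\})\le c\,w(E)$$ for all measurable sets $E\subseteq\mathbb{R}^n$. *)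

(* Defs.v *)
From HB Require Import structures.
From mathcomp Require Import all_boot all_order all_algebra.
From mathcomp Require Import all_classical all_reals all_analysis.

Set Implicit Arguments.
Unset Strict Implicit.
Unset Printing Implicit Defensive.

Import Order.TTheory GRing.Theory Num.Theory.
Import numFieldNormedType.Exports.

Local Open Scope classical_set_scope.
Local Open Scope ring_scope.
Local Open Scope ereal_scope.

(* The library has no Lebesgue measure in dimension greater than 1.  R^d with
   d >= 1 is 'rV[R]_n.+1 (d = n.+1).  We take the usual Lebesgue outer measure
   (countable covers by closed boxes); the Lebesgue measurable sets are the
   Caratheodory measurable ones, so the resulting measure is complete. *)

Definition box (R : realType) (n : nat) (a b : 'rV[R]_n.+1) :
    set 'rV[R]_n.+1 :=
  [set x | forall i, (a ord0 i <= x ord0 i <= b ord0 i)%R].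

(* The maximum makes the volume 0 when the box is empty. *)
Definition box_volume (R : realType) (n : nat) (a b : 'rV[R]_n.+1) : R :=
  (\prod_(i < n.+1) Num.max 0 (b ord0 i - a ord0 i))%R.

Definition box_cover (R : realType) (n : nat) (A : set 'rV[R]_n.+1) :
    set (nat -> 'rV[R]_n.+1 * 'rV[R]_n.+1) :=
  [set F | A `<=` \bigcup_k box (F k).1 (F k).2].

Definition lebesgue_outer (R : realType) (n : nat) (A : set 'rV[R]_n.+1) :
    \bar R :=
  ereal_inf [set \sum_(k <oo) (box_volume (F k).1 (F k).2)%:E
            | F in box_cover A].

Section lebesgue_outer_measure.
Context (R : realType) (n : nat).
Notation V := 'rV[R]_n.+1.
Notation lam := (@lebesgue_outer R n).

Lemma box_volume_ge0 (a b : V) : (0 <= box_volume a b)%R.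
Proof. by apply: prodr_ge0 => i _; rewrite le_max lexx. Qed.

Lemma lebesgue_outer_ge0 (A : set V) : 0 <= lam A.
Proof.
apply: le_ereal_inf_tmp => _ [F _ <-]; apply: nneseries_ge0 => k _ _.
by rewrite lee_fin box_volume_ge0.
Qed.

Lemma le_lebesgue_outer : {homo lam : A B / A `<=` B >-> A <= B}.
Proof.
move=> A B AB; apply/ereal_inf_le_tmp => _ [F BF <-].
by exists F => //; exact: subset_trans BF.
Qed.

Lemma lebesgue_outer0 : lam set0 = 0.
Proof.
apply/eqP; rewrite eq_le lebesgue_outer_ge0 andbT.
apply: ereal_inf_lbound; exists (fun=> (0%R, 0%R)) => //=.
apply: eseries0 => k _ _; congr EFin; rewrite /box_volume.
by rewrite big_ord_recl mxE subr0 maxxx mul0r.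
Qed.

Lemma lebesgue_outer_sigma_subadditive : sigma_subadditive lam.
Proof.
move=> A; have [[i ioo]|] := pselect (exists i, lam (A i) = +oo).
  rewrite (eseries_pinfty _ _ ioo) ?leey// => k _.
  by rewrite -ltNye (lt_le_trans _ (lebesgue_outer_ge0 _)).
rewrite -forallNE => Aoo.
suff add2e (e : {posnum R}) :
    lam (\bigcup_n A n) <= \sum_(i <oo) lam (A i) + e%:num%:E.
  by apply/lee_addgt0Pr => _/posnumP[].
rewrite (le_trans _ (epsilon_trick _ _ _))//; last first.
  by move=> k; exact: lebesgue_outer_ge0.
pose vol (q : V * V) := (box_volume q.1 q.2)%:E.
have vol_ge0 q : 0 <= vol q by rewrite lee_fin box_volume_ge0.
pose P k (B : nat -> V * V) := box_cover (A k) B /\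
  \sum_(j <oo) vol (B j) <= lam (A k) + (e%:num / (2 ^ k.+1)%:R)%:E.
have [G PG] : {G : nat -> nat -> V * V & forall k, P k (G k)}.
  apply: (@choice _ _ P) => k; rewrite /P /lebesgue_outer.
  set S := (X in ereal_inf X); move infS : (ereal_inf S) => iS.
  case: iS infS => [r Sr|Soo|Soo].
  - have en1 : (0 < e%:num / (2 ^ k.+1)%:R)%R by [].
    have /(lb_ereal_inf_adherent en1) : ereal_inf S \is a fin_num by rewrite Sr.
    move=> [x [B AkB muBx] xS].
    by exists B; split => //; rewrite muBx -Sr; exact/ltW.
  - by have := Aoo k; rewrite /lebesgue_outer Soo.
  - suff : lbound S 0 by move/le_ereal_inf_tmp; rewrite Soo.
    by move=> /= _ [B AkB <-]; apply: nneseries_ge0 => j _ _; exact: vol_ge0.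
apply: (@le_trans _ _ (\esum_(i in setT) (vol \o uncurry G) i)).
  apply: ereal_inf_lbound => /=.
  have /card_esym/ppcard_eqP[f] := card_nat2.
  exists (uncurry G \o f).
    move=> t [i _ Ait]; have [j _ Gt] := (PG i).1 t Ait.
    by exists (f^-1%FUN (i, j)) => //=; rewrite invK ?inE.
  rewrite -(esum_pred_image (vol \o uncurry G) _ xpredT) ?[fun=> _]set_true//.
  - by rewrite image_eq.
  - by move=> k _; exact: vol_ge0.
rewrite (_ : esum _ _ = \sum_(i <oo) \sum_(j <oo ) vol (G i j)); last first.
  pose J : nat -> set (nat * nat) := fun i => [set (i, j) | j in setT].
  rewrite (_ : setT = \bigcup_k J k); last first.
    by rewrite predeqE => -[a b]; split => // _; exists a => //; exists b.
  rewrite esum_bigcupT /=; last 2 first.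
    - apply/trivIsetP => i j _ _ ij.
      rewrite predeqE => -[k m] /=; split => //= -[] [_] _ [<-{k} _].
      by move=> [m' _] [] /esym/eqP; rewrite (negbTE ij).
    - by move=> /= q; exact: vol_ge0.
  rewrite -(image_id [set: nat]) -fun_true esum_pred_image//; last first.
    by move=> k _; apply: esum_ge0 => q _; exact: vol_ge0.
  apply: eq_eseriesr => /= j _.
  rewrite -(esum_pred_image (vol \o uncurry G) (pair j) predT)//=; last first.
    by move=> ? ? _ _; exact: (@can_inj _ _ _ snd).
  by congr esum; rewrite predeqE => -[a b]; split; move=> [i _ <-]; exists i.
apply: lee_lim.
- apply: is_cvg_nneseries => k *.
  by apply: nneseries_ge0 => m *; exact: vol_ge0.
- apply: is_cvg_nneseries => k *; apply: adde_ge0 => //.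
  exact: lebesgue_outer_ge0.
- by near=> k; apply: lee_sum => i _; exact: (PG i).2.
Unshelve. all: by end_near. Qed.

HB.instance Definition _ := isOuterMeasure.Build R V lam
  lebesgue_outer0 lebesgue_outer_ge0 le_lebesgue_outer
  lebesgue_outer_sigma_subadditive.

End lebesgue_outer_measure.

Section lebesgue_measure_rV.
Context (R : realType) (n : nat).
Notation V := 'rV[R]_n.+1.
Notation lam := (@lebesgue_outer R n).

HB.instance Definition _ := @isMeasurable.Build (caratheodory_display lam) V
  (caratheodory_measurable lam)
  (caratheodory_measurable_set0 lam)
  (@caratheodory_measurable_setC _ _ lam)
  (@caratheodory_measurable_bigcup _ _ lam).

Definition lebesgue_rV (A : set V) : \bar R := lam A.

HB.instance Definition _ := isMeasure.Build _ V R lebesgue_rV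
  (@caratheodory_measure0 R V lam) (@caratheodory_measure_ge0 R V lam)
  (@caratheodory_measure_sigma_additive R V lam).

End lebesgue_measure_rV.

Arguments lebesgue_rV {R n} A.

Definition is_basis (R : realType) (n : nat) (Bs : set (set 'rV[R]_n.+1)) :
    Prop :=
  forall B, Bs B -> open B /\ bounded_set B.

Definition locally_integrable_rV (R : realType) (n : nat)
    (w : 'rV[R]_n.+1 -> R) : Prop :=
  measurable_fun [set: 'rV[R]_n.+1] w /\
  forall K : set 'rV[R]_n.+1, compact K ->
    \int[lebesgue_rV]_(x in K) `|w x|%:E < +oo.

Definition is_weight (R : realType) (n : nat) (w : 'rV[R]_n.+1 -> R) : Prop :=
  (forall x, (0 <= w x)%R) /\ locally_integrable_rV w.

Definition weight_mass (R : realType) (n : nat) (w : 'rV[R]_n.+1 -> R)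
    (E : set 'rV[R]_n.+1) : \bar R :=
  \int[lebesgue_rV]_(x in E) (w x)%:E.

Definition weighted_Lp (R : realType) (n : nat) (p : R)
    (w : 'rV[R]_n.+1 -> R) : set ('rV[R]_n.+1 -> R) :=
  [set f : 'rV[R]_n.+1 -> R | measurable_fun [set: 'rV[R]_n.+1] f /\
           \int[lebesgue_rV]_x (`|f x| `^ p * w x)%:E < +oo].

Definition average (R : realType) (n : nat) (B : set 'rV[R]_n.+1)
    (g : 'rV[R]_n.+1 -> \bar R) : \bar R :=
  (lebesgue_rV B)^-1 * \int[lebesgue_rV]_(y in B) g y.

(* Functions are extended-real valued because f / sigma may be infinite; the
   library's conventions on \bar R are 0^-1 = +oo, +oo^-1 = 0 and 0 * +oo = 0.
   Adding 0 to the (nonnegative) averages gives the value 0 at the points that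
   no element of the basis contains. *)

Definition hl_maximal (R : realType) (n : nat) (Bs : set (set 'rV[R]_n.+1))
    (f : 'rV[R]_n.+1 -> \bar R) (x : 'rV[R]_n.+1) : \bar R :=
  ereal_sup ([set 0] `|`
    [set average B (fun y => `|f y|) | B in [set B | Bs B /\ B x]]).

Definition harmonic_maximal (R : realType) (n : nat)
    (Bs : set (set 'rV[R]_n.+1)) (f : 'rV[R]_n.+1 -> \bar R)
    (x : 'rV[R]_n.+1) : \bar R :=
  ereal_sup ([set 0] `|`
    [set (average B (fun y => `|f y|^-1))^-1 | B in [set B | Bs B /\ B x]]).

Definition hl_maximal_bounded (R : realType) (n : nat)
    (Bs : set (set 'rV[R]_n.+1)) (s : R) : Prop :=
  exists C : R, forall f : 'rV[R]_n.+1 -> R,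
    f \in Lfun (@lebesgue_rV R n) s%:E ->
    Lnorm lebesgue_rV s%:E (hl_maximal Bs (EFin \o f)) <=
      C%:E * Lnorm lebesgue_rV s%:E (EFin \o f).

Definition condition_A (R : realType) (n : nat) (Bs : set (set 'rV[R]_n.+1))
    (w : 'rV[R]_n.+1 -> R) : Prop :=
  exists alpha c : R, [/\ (0 < alpha)%R, (alpha < 1)%R &
    forall E : set 'rV[R]_n.+1, measurable E ->
      weight_mass w [set x | alpha%:E < hl_maximal Bs (EFin \o \1_E) x] <=
        c%:E * weight_mass w E].

(* Main.v *)
(** Write h = |f|^p sigma and q = r / (p + 1 - pr) < 1.  If t is smaller than
    (avg_B sigma / |f|)^-1, Hoelder's inequality applied to
    sigma^r = (sigma / |f|)^(pr/(p+1)) h^(r/(p+1)) turns the bump condition into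
    t^p u(B) <= C |B| (avg_B h^q)^(1/q).  From finitely many pairs (t, B), taken
    by decreasing t, keep B when at most the fraction alpha of it is covered by
    the sets kept before.  Condition A bounds the u-mass of the union of any
    upper part of the family by that of its kept sets, so Abel summation in t
    bounds the integral of max t^p 1_B against u by the sum of t^p u(B) over the
    kept B.  The new part of a kept B has measure at least (1 - alpha) |B|, and
    the new parts are disjoint, so this sum is at most a constant times the
    integral of (M(h^q))^(1/q), which the boundedness of M on L^(1/q) controls.
    A countable subfamily of pairs determines the harmonic maximal function, and
    Fatou's lemma concludes. *)
Require Import Defs.
From HB Require Import structures.
From mathcomp Require Import all_boot all_order all_algebra.
From mathcomp Require Import all_classical all_reals all_analysis measurable_realfun.
From mathcomp Require Import ring lra.
Set Implicit Arguments.
Unset Strict Implicit.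
Unset Printing Implicit Defensive.

Import Order.TTheory GRing.Theory Num.Theory.
Import numFieldNormedType.Exports.
Local Open Scope classical_set_scope.
Local Open Scope ring_scope.
Local Open Scope ereal_scope.

(** * Measurability of open sets for the Lebesgue outer measure *)

(** Cutting at the hyperplane [x_i = c] changes only the [i]-th side, and the two truncated lengths
    add up even when the box is empty. *)
Lemma box_volume_split (R : realType) (n : nat) (i : 'I_n.+1) (c : R)
    (a b : 'rV[R]_n.+1) :
  box_volume a b =
    (box_volume a (\row_j if j == i then Num.min (b ord0 j) c else b ord0 j) +
     box_volume (\row_j if j == i then Num.max (a ord0 j) c else a ord0 j) b)%R.
Proof.
rewrite /box_volume (bigD1 i)//= [X in (_ = X + _)%R](bigD1 i)//=.
rewrite [X in (_ = _ + X)%R](bigD1 i)//= !mxE eqxx.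
rewrite [X in (_ = X + _)%R](_ : _ = Num.max 0 (Num.min (b ord0 i) c - a ord0 i) *
  \prod_(j < n.+1 | j != i) Num.max 0 (b ord0 j - a ord0 j))%R; last first.
  by congr (_ * _)%R; apply: eq_bigr => j ji; rewrite mxE (negbTE ji).
rewrite [X in (_ = _ + X)%R](_ : _ = Num.max 0 (b ord0 i - Num.max (a ord0 i) c) *
  \prod_(j < n.+1 | j != i) Num.max 0 (b ord0 j - a ord0 j))%R; last first.
  by congr (_ * _)%R; apply: eq_bigr => j ji; rewrite mxE (negbTE ji).
rewrite -mulrDl; congr (_ * _)%R.
rewrite /Num.max /Num.min; do !case: ifPn; rewrite -?leNgt => *; lra.
Qed.

(** Caratheodory's criterion: cutting every box of a cover of [X] along the hyperplane yields covers
    of both pieces of [X] with the same total volume. *)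
Lemma measurable_halfspace (R : realType) (n : nat) (i : 'I_n.+1) (c : R) :
  measurable [set x : 'rV[R]_n.+1 | (x ord0 i <= c)%R].
Proof.
apply: le_caratheodory_measurable => /= X.
apply: le_ereal_inf_tmp => _ [F XF <-].
pose F1 k := ((F k).1,
  \row_j if j == i then Num.min ((F k).2 ord0 j) c else (F k).2 ord0 j).
pose F2 k := (\row_j if j == i then Num.max ((F k).1 ord0 j) c
  else (F k).1 ord0 j, (F k).2).
have -> : \sum_(k <oo) (box_volume (F k).1 (F k).2)%:E =
    \sum_(k <oo) (box_volume (F1 k).1 (F1 k).2)%:E +
    \sum_(k <oo) (box_volume (F2 k).1 (F2 k).2)%:E.
  rewrite -nneseriesD; [|by move=> *; rewrite lee_fin box_volume_ge0..].
  by apply: eq_eseriesr => k _; rewrite -EFinD -box_volume_split.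
apply: leeD; apply: ereal_inf_lbound; [exists F1|exists F2] => //= x [/XF].
- move=> [k _ xk] xc; exists k => //= j; rewrite mxE.
  have /andP[-> h] := xk j; case: eqP => //= ji.
  by rewrite le_min h ji xc.
- move=> [k _ xk] /= /negP; rewrite -ltNge => xc; exists k => //= j; rewrite mxE.
  have /andP[h ->] := xk j; rewrite andbT; case: eqP => //= ji.
  by rewrite ge_max h ji ltW.
Qed.

Lemma measurable_mxball (R : realType) (n : nat) (x : 'rV[R]_n.+1) (e : R) :
  measurable (ball x e).
Proof.
have -> : ball x e = \bigcap_(i in [set: 'I_n.+1])
    (~` [set y : 'rV[R]_n.+1 | (y ord0 i <= x ord0 i - e)%R] `&`
     (\bigcup_k [set y : 'rV[R]_n.+1 | (y ord0 i <= x ord0 i + e - k.+1%:R^-1)%R])).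
  apply/seteqP; split => [y [_ xy] i _|y H].
    have := xy ord0 i; rewrite /ball/= ltr_distlC => /andP[h1 h2]; split.
      by apply/negP; rewrite -ltNge.
    have [k hk] := ltr_add_invr h2.
    by exists k => //=; rewrite lerBrDr ltW.
  have xye i : (x ord0 i - e < y ord0 i < x ord0 i + e)%R.
    have [/negP + [k _ /=]] := H i I; rewrite -ltNge => -> h2 /=.
    by rewrite (le_lt_trans h2)// ltrBlDr ltrDl invr_gt0.
  (* Membership in a ball of matrices includes positivity of the radius, which the bounds on any one
     coordinate give. *)
  split; first by have := xye ord0; lra.
  by move=> j i; rewrite ord1 /ball/= ltr_distlC xye.
apply: fin_bigcap_measurable => // i _; apply: measurableI.
  by apply: measurableC; exact: measurable_halfspace.
by apply: bigcupT_measurable => k; exact: measurable_halfspace.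
Qed.

Definition rational_ball (R : realType) (n : nat) (c : 'rV[rat]_n.+1 * nat) :
    set 'rV[R]_n.+1 := ball (map_mx (@ratr R) c.1 : 'rV[R]_n.+1) c.2.+1%:R^-1.

Lemma rational_ball_sub (R : realType) (n : nat) (O : set 'rV[R]_n.+1) x :
  open O -> O x -> exists c, rational_ball c x /\ @rational_ball R n c `<=` O.
Proof.
move=> oO Ox; have /nbhs_ballP[e /= e0 xeO] : nbhs x O by exact: open_nbhs_nbhs.
have [k] := ltr_add_invr e0; rewrite add0r => ke.
(* The radius is at most half of [k.+1%:R^-1] because the triangle inequality through the rational
   centre costs two radii. *)
have [k' k'k] : exists k' : nat, (k'.+1%:R^-1 <= k.+1%:R^-1 / 2 :> R)%R.
  by exists (k.+1 + k.+1)%N; rewrite -invfM lef_pV2 ?posrE// -natrM ler_nat muln2 -addnn.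
have /choice[q xq] (i : 'I_n.+1) : exists q : rat,
    (`|ratr q - x ord0 i| < k'.+1%:R^-1)%R.
  have [|q] := @rat_in_itvoo R (x ord0 i) (x ord0 i + k'.+1%:R^-1)%R.
    by rewrite ltrDl invr_gt0.
  rewrite in_itv/= => /andP[xq qx]; exists q.
  by rewrite ger0_norm ?subr_ge0 ?ltW// ltrBlDl.
pose c : 'rV[rat]_n.+1 * nat := (\row_i q i, k').
have cx : rational_ball c x.
  by split; [rewrite invr_gt0|move=> j i; rewrite ord1 !mxE; exact: xq].
exists c; split => // y cy; apply: xeO.
apply: (@le_ball _ _ _ (k'.+1%:R^-1 + k'.+1%:R^-1)%R).
  by rewrite (le_trans (lerD k'k k'k))// -splitr ltW.
exact: ball_triangle (ball_sym cx) cy.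
Qed.

Lemma measurable_open_rV (R : realType) (n : nat) (O : set 'rV[R]_n.+1) :
  open O -> measurable O.
Proof.
move=> oO; have -> : O = \bigcup_k (if unpickle k is Some c then
    [set x | rational_ball c x /\ @rational_ball R n c `<=` O] else set0).
  apply/seteqP; split => [x Ox|x [k _]].
    by have [c cP] := rational_ball_sub oO Ox; exists (pickle c); rewrite ?pickleK.
  by case: unpickle => // c [cx]; exact.
apply: bigcupT_measurable => k; case: unpickle => [c|//].
have [cO|cO] := pselect (@rational_ball R n c `<=` O).
  rewrite (_ : [set x | _] = rational_ball c); first exact: measurable_mxball.
  by apply/seteqP; split => [x []|].
by rewrite (_ : [set x | _] = set0)//; apply/seteqP; split => [x []|].
Qed.

(** * Suprema over the elements of a basis containing a point *)

(** Both maximal operators are convertible to this form, [phi B] being an average over [B] or the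
    inverse of one, so each fact below serves both. *)
Definition basis_sup (R : realType) (n : nat) (Bs : set (set 'rV[R]_n.+1))
    (phi : set 'rV[R]_n.+1 -> \bar R) (x : 'rV[R]_n.+1) : \bar R :=
  ereal_sup ([set 0] `|` [set phi B | B in [set B | Bs B /\ B x]]).

Lemma basis_sup_ge0 (R : realType) (n : nat) (Bs : set (set 'rV[R]_n.+1)) phi x :
  0 <= basis_sup Bs phi x.
Proof. by apply: ereal_sup_ubound; left. Qed.

Lemma le_basis_sup (R : realType) (n : nat) (Bs : set (set 'rV[R]_n.+1)) phi B x :
  Bs B -> B x -> phi B <= basis_sup Bs phi x.
Proof. by move=> BsB Bx; apply: ereal_sup_ubound; right; exists B. Qed.

Lemma basis_sup_gt (R : realType) (n : nat) (Bs : set (set 'rV[R]_n.+1)) phi x y :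
  0 <= y -> y < basis_sup Bs phi x -> exists B, [/\ Bs B, B x & y < phi B].
Proof.
move=> y0 /ereal_sup_gt[_ [->|[B [BsB Bx] <-]]]; first by rewrite ltNge y0.
by move=> yB; exists B.
Qed.

(** For an arbitrary [phi], a superlevel set at a level [a >= 0] is a union of open elements of the
    basis; at a negative level it is the whole space. *)
Lemma measurable_basis_sup (R : realType) (n : nat) (Bs : set (set 'rV[R]_n.+1))
    phi : is_basis Bs -> measurable_fun [set: 'rV[R]_n.+1] (basis_sup Bs phi).
Proof.
move=> basis; apply: (measurability _ (ErealGenOInfty.measurableE R)).
move=> _ [_ [a ->] <-]; apply: measurableI => //; rewrite preimage_itvoy.
have [a0|a0] := leP 0%R a; last first.
  rewrite (_ : [set x | _] = setT)//; apply/seteqP; split => // x _ /=.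
  by rewrite (lt_le_trans _ (basis_sup_ge0 _ _ _))// lte_fin.
apply: measurable_open_rV.
rewrite (_ : [set x | _] = \bigcup_(B in [set B | Bs B /\ a%:E < phi B]) B).
  by apply: bigcup_open => B [/basis[]].
apply/seteqP; split => [x /= /basis_sup_gt[|B [BsB Bx aB]]|x [B [BsB aB] Bx]].
- by rewrite lee_fin.
- by exists B.
- exact: lt_le_trans aB (le_basis_sup _ _ _).
Qed.

(* The rational levels and the rational balls make a countable subfamily
   sufficient: [B k] is a witness for one level and one ball, or [set0] if there
   is none. *)
Lemma basis_sup_countable (R : realType) (n : nat) (Bs : set (set 'rV[R]_n.+1))
    phi : is_basis Bs ->
  exists (t : nat -> R) (B : nat -> set 'rV[R]_n.+1),
    (forall k, (0 < t k)%R /\ (B k = set0 \/ Bs (B k) /\ (t k)%:E < phi (B k))) /\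
    forall x (s : R), (0 <= s)%R -> s%:E < basis_sup Bs phi x ->
      exists k, (s < t k)%R /\ B k x.
Proof.
move=> basis; pose P (c : rat * ('rV[rat]_n.+1 * nat)) B :=
  [/\ Bs B, (ratr c.1)%:E < phi B & rational_ball c.2 `<=` B].
have /choice[tB tBP] (k : nat) : exists z : R * set 'rV[R]_n.+1,
    ((0 < z.1)%R /\ (z.2 = set0 \/ Bs z.2 /\ z.1%:E < phi z.2)) /\
    forall c : rat * ('rV[rat]_n.+1 * nat),
      unpickle k = Some c -> (0 < c.1)%R -> (exists B, P c B) ->
      z.1 = ratr c.1 /\ P c z.2.
  case: unpickle => [c|]; last first.
    by exists (1%R, set0); split => //; split => //; left.
  have [[c0 [B cB]]|cP] := pselect ((0 < c.1)%R /\ exists B, P c B).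
    exists (ratr c.1, B); split => /=; last by move=> _ [<-].
    by rewrite ltr0q; split => //; right; case: cB.
  exists (1%R, set0); split; first by split => //; left.
  by move=> d [<-] d0 dP; exfalso; apply: cP.
exists (fun k => (tB k).1), (fun k => (tB k).2).
split => [k|x s s0 /basis_sup_gt[|B [BsB Bx sB]]]; first exact: (tBP k).1.
  by rewrite lee_fin.
have [oB _] := basis _ BsB; have [c [cx cB]] := rational_ball_sub oB Bx.
have [q [sq qB]] : exists q : rat, (s < ratr q)%R /\ (ratr q)%:E < phi B.
  case: (phi B) sB => [y|_|//].
    rewrite lte_fin => /rat_in_itvoo[q]; rewrite in_itv/= => /andP[sq qy].
    by exists q; rewrite lte_fin.
  have [|q] := @rat_in_itvoo R s (s + 1); first by rewrite ltrDl.
  by rewrite in_itv/= => /andP[sq _]; exists q; rewrite ltry.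
have q0 : (0 < q)%R by rewrite -(ltr0q R) (le_lt_trans s0).
have [|zq [_ _ cz]] := (tBP (pickle (q, c))).2 (q, c) (pickleK _) q0.
  by exists B; split.
by exists (pickle (q, c)); rewrite zq; split => //; exact: cz.
Qed.

(** * Greedy selection and Abel summation over levels *)

Lemma ge0_integral_setU_le d (T : measurableType d) (R : realType)
    (mu : {measure set T -> \bar R}) (A B : set T) (f : T -> \bar R) :
  measurable A -> measurable B -> measurable_fun setT f ->
  (forall x, 0 <= f x) ->
  \int[mu]_(x in A `|` B) f x <=
    \int[mu]_(x in A) f x + \int[mu]_(x in B) f x.
Proof.
move=> mA mB mf f0; have -> : A `|` B = A `|` (B `\` A).
  by apply/seteqP; split => x; rewrite /setU/setD/=; have [] := pselect (A x); tauto.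
have mD : measurable (B `\` A) by exact: measurableD.
rewrite ge0_integral_setU//; [|exact: measurable_funTS|].
  apply: leeD => //; apply: ge0_subset_integral => //.
  exact: measurable_funTS.
by apply/eqP; rewrite setIC setDE -setIA setICl setI0.
Qed.

Section covering.
Context d (T : measurableType d) (R : realType) (mu : {measure set T -> \bar R}).
Variables (B : nat -> set T) (alpha : R).
Hypothesis mB : forall k, measurable (B k).

(* The list is processed from its end, so that with [l] listed by increasing
   [a] (see [levels]) the sets with the largest [a] are selected first. *)
Fixpoint select (l : seq nat) : seq nat :=
  if l is k :: l' then
    if mu (B k `&` \big[setU/set0]_(j <- select l') B j) <= alpha%:E * mu (B k)
    then k :: select l' else select l'
  else [::].

Lemma select_sub l : {subset select l <= l}.
Proof.
elim: l => //= k l ih j; case: ifP => _; rewrite !inE.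
  by case: eqP => //= _ /ih.
by move/ih => ->; rewrite orbT.
Qed.

Lemma measurable_bigcup_seq (l : seq nat) :
  measurable (\big[setU/set0]_(k <- l) B k).
Proof. by apply: bigsetU_measurable. Qed.

(** A discarded set is overlapped by the sets kept before it in more than the fraction [alpha], and
    later selections only enlarge this overlap. *)
Lemma select_cover l x : (\big[setU/set0]_(k <- l) B k) x ->
  (\big[setU/set0]_(k <- select l) B k) x \/
  exists k, B k x /\
    alpha%:E * mu (B k) < mu (B k `&` \big[setU/set0]_(j <- select l) B j).
Proof.
elim: l => [|k l ih]; first by left.
rewrite big_cons /=; case: ifPn => [_|].
  rewrite big_cons => -[kx|/ih[lx|[j [jx hj]]]]; [by left; left|by left; right|].
  right; exists j; split => //; apply: lt_le_trans hj _.
  apply: le_measure; rewrite ?inE; [| |by apply: setIS; exact: subsetUr];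
    apply: measurableI => //; [|apply: measurableU => //];
    exact: measurable_bigcup_seq.
by rewrite -ltNge => hk -[kx|/ih//]; right; exists k.
Qed.

(** The hypothesis on [v k] is applied to the part of [B k] that is new when [k] is kept; these
    parts are disjoint, so their integrals add up to one over the union. *)
Lemma select_integral (H : T -> \bar R) (v : nat -> \bar R) l :
  measurable_fun setT H -> (forall x, 0 <= H x) ->
  (forall k E, measurable E -> E `<=` B k ->
     mu (B k `\` E) <= alpha%:E * mu (B k) -> v k <= \int[mu]_(x in E) H x) ->
  \sum_(k <- select l) v k <=
    \int[mu]_(x in \big[setU/set0]_(k <- select l) B k) H x.
Proof.
move=> mH H0 hv; elim: l => [|k l ih]; first by rewrite !big_nil integral_set0.
rewrite /=; case: ifPn => // hk; rewrite !big_cons.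
set S := \big[setU/set0]_(j <- select l) B j.
have mS : measurable S by exact: measurable_bigcup_seq.
have -> : B k `|` S = (B k `\` S) `|` S.
  by apply/seteqP; split => x; rewrite /setU/setD/=; have [] := pselect (S x); tauto.
have mD : measurable (B k `\` S) by exact: measurableD.
rewrite ge0_integral_setU//; [|exact: measurable_funTS|]; last first.
  by apply/eqP; rewrite setDE -setIA setICl setI0.
apply: leeD => //.
apply: hv => //.
(* What the new part misses of [B k] is its overlap with [S], the set tested by [select]. *)
by rewrite setDD.
Qed.

(* Abel summation: for [l] listed by increasing [a], this is
   max_(k in l) (a k - s) 1_(B k). *)
Fixpoint levels (a : nat -> R) (s : R) (l : seq nat) (x : T) : R :=
  if l is k :: l' then
    ((a k - s) * \1_(\big[setU/set0]_(j <- l) B j) x + levels a (a k) l' x)%R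
  else 0%R.

Lemma levels_ge0 a s l x : all (fun k => s <= a k)%R l ->
  sorted (relpre a <=%R) l -> (0 <= levels a s l x)%R.
Proof.
elim: l s => //= k l ih s /andP[sk sl] al.
apply: addr_ge0; first by rewrite mulr_ge0// subr_ge0.
apply: ih; last exact: path_sorted al.
by apply: (order_path_min _ al) => i j m /=; exact: le_trans.
Qed.

(** At a point of [B k] the indicators of all unions from the head of [l] down to [k] equal 1, so
    the increments of [a] telescope to [a k - s]; the later terms are nonnegative. *)
Lemma le_levels a s l x k : all (fun k => s <= a k)%R l ->
  sorted (relpre a <=%R) l -> k \in l -> B k x -> (a k - s <= levels a s l x)%R.
Proof.
elim: l s => //= j l ih s /andP[sj sl] al.
have jl : all (fun k => a j <= a k)%R l.
  by apply: (order_path_min _ al) => i m q /=; exact: le_trans.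
have sal := path_sorted al.
have U1 i : i \in j :: l -> B i x -> (\big[setU/set0]_(j <- j :: l) B j) x.
  by move=> il ix; rewrite -bigcup_seq; exists i.
move=> kl kx; rewrite indicE mem_set ?mulr1; last exact: U1 kx.
move: kl; rewrite inE => /predU1P[->|kl].
  by rewrite lerDl levels_ge0.
by have := ih _ jl sal kl kx; lra.
Qed.

Lemma measurable_levels a s l : measurable_fun setT (levels a s l).
Proof.
elim: l s => [|k l ih] s /=; first exact: measurable_cst.
apply: measurable_funD => //; apply: measurable_funM => //.
exact/measurable_indic/measurable_bigcup_seq.
Qed.

(** Induction on [l]: the head adds [a k - s] times the mass of the whole union, which raises the
    coefficient of each kept [j] from [a j - a k] to [a j - s]. The mass bound is assumed for every
    list because each tail of [l] uses it. *)
Lemma integral_levels (u : T -> R) (a : nat -> R) (c s : R) l :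
  measurable_fun setT u -> (forall x, 0 <= u x)%R -> (0 <= c)%R ->
  (forall l, \int[mu]_(x in \big[setU/set0]_(k <- l) B k) (u x)%:E <=
    c%:E * \int[mu]_(x in \big[setU/set0]_(k <- select l) B k) (u x)%:E) ->
  all (fun k => s <= a k)%R l -> sorted (relpre a <=%R) l ->
  \int[mu]_x (levels a s l x * u x)%:E <=
    c%:E * \sum_(k <- select l) (a k - s)%:E * \int[mu]_(x in B k) (u x)%:E.
Proof.
move=> mu_u u0 c0 hc; elim: l s => [|k l ih] s.
  by move=> _ _; rewrite big_nil mule0 integral0_eq// => x _; rewrite mul0r.
move=> /[dup] skl /= /andP[sk sl] al.
have kl : all (fun j => a k <= a j)%R l.
  by apply: (order_path_min _ al) => i m q /=; exact: le_trans.
have sal := path_sorted al.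
have int0 A : 0 <= \int[mu]_(x in A) (u x)%:E.
  by apply: integral_ge0 => x _; rewrite lee_fin.
set U := \big[setU/set0]_(j <- k :: l) B j.
have mU : measurable U by exact: measurable_bigcup_seq.
have -> : \int[mu]_x (((a k - s) * \1_U x + levels a (a k) l x) * u x)%:E =
    (a k - s)%:E * \int[mu]_(x in U) (u x)%:E +
    \int[mu]_x (levels a (a k) l x * u x)%:E.
  under eq_integral do rewrite mulrDl EFinD -mulrA EFinM.
  rewrite ge0_integralD//=; first last.
  - by apply/measurable_EFinP; apply: measurable_funM => //; exact: measurable_levels.
  - by move=> x _; rewrite lee_fin mulr_ge0// levels_ge0.
  - apply: measurable_funeM; apply/measurable_EFinP; apply: measurable_funM => //.
  - by move=> x _; rewrite mule_ge0 ?lee_fin ?subr_ge0// mulr_ge0.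
  rewrite ge0_integralZl//=; first last.
  - by rewrite lee_fin subr_ge0.
  - by move=> x _; rewrite lee_fin mulr_ge0.
  - apply/measurable_EFinP; apply: measurable_funM => //.
  congr (_ * _ + _); rewrite [RHS]integral_mkcond; apply: eq_integral => x _.
  by rewrite patchE indicE; case: ifP => _; rewrite ?mul1r ?mul0r.
have nuU : \int[mu]_(x in U) (u x)%:E <=
    c%:E * \sum_(j <- select (k :: l)) \int[mu]_(x in B j) (u x)%:E.
  apply: (le_trans (hc _)); apply: lee_wpmul2l; first by rewrite lee_fin.
  elim: (select (k :: l)) => [|j s' ih']; first by rewrite !big_nil integral_set0.
  rewrite !big_cons; apply: le_trans (leeD2l _ ih').
  apply: ge0_integral_setU_le => //; first exact: measurable_bigcup_seq.
  exact/measurable_EFinP.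
apply: (le_trans (leeD (lee_wpmul2l _ nuU) (ih _ kl sal))).
  by rewrite lee_fin subr_ge0.
rewrite muleCA -ge0_muleDr ?mule_ge0 ?lee_fin ?subr_ge0//; first last.
- rewrite big_seq; apply: sume_ge0 => j /select_sub jl; have := allP kl _ jl => akj.
  by rewrite mule_ge0// lee_fin subr_ge0.
- by apply: sume_ge0.
apply: lee_wpmul2l; first by rewrite lee_fin.
(* If [k] is kept, its coefficient [a k - a k] vanishes, so both sums may run over
   [select (k :: l)]. *)
rewrite [X in _ + X](_ : _ = \sum_(j <- select (k :: l))
    (a j - a k)%:E * \int[mu]_(x in B j) (u x)%:E); last first.
  by rewrite /=; case: ifP => // _; rewrite big_cons subrr mul0e add0e.
rewrite ge0_sume_distrr// -big_split/= big_seq [leRHS]big_seq.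
apply: lee_sum => j jS; have := @select_sub (k :: l) j jS; rewrite inE => jkl.
have akj : (a k <= a j)%R by case/predU1P: jkl => [->//|jl]; last exact: (allP kl).
rewrite -ge0_muleDl ?lee_fin ?subr_ge0// -EFinD.
by rewrite addrC addrA subrK.
Qed.

End covering.

(** * Hoelder's inequality and the estimate on a single set *)

Lemma hoelder_powR d (T : measurableType d) (R : realType)
    (mu : {measure set T -> \bar R}) (D : set T) (l k : T -> R) (a : R) :
  measurable D -> measurable_fun setT l -> measurable_fun setT k ->
  (forall x, 0 <= l x)%R -> (forall x, 0 <= k x)%R -> (0 < a < 1)%R ->
  \int[mu]_(x in D) (l x `^ a * k x `^ (1 - a))%:E <=
    (\int[mu]_(x in D) (l x)%:E) `^ a * (\int[mu]_(x in D) (k x)%:E) `^ (1 - a).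
Proof.
move=> mD ml mk l0 k0 /andP[a0 a1].
have b0 : (0 < 1 - a)%R by rewrite subr_gt0.
have aux (g : T -> R) (e : R) : (forall x, 0 <= g x)%R -> (0 < e)%R ->
    'N[mu]_(e^-1)%:E[EFin \o (fun x => g x `^ e * \1_D x)%R] =
    (\int[mu]_(x in D) (g x)%:E) `^ e.
  move=> g0 e0; rewrite unlock invrK; congr (_ `^ _).
  rewrite [RHS]integral_mkcond; apply: eq_integral => x _ /=.
  rewrite patchE indicE; case: ifP => _.
    by rewrite mulr1 ger0_norm ?powR_ge0// -powRrM divff ?gt_eqF// powRr1.
  by rewrite mulr0 normr0 powR0// invr_neq0// gt_eqF.
have mX (g : T -> R) e : measurable_fun setT g ->
    measurable_fun setT (fun x => g x `^ e * \1_D x)%R.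
  move=> mg; apply: measurable_funM; last exact: measurable_indic.
  exact: (measurableT_comp (measurable_powR _)).
have := hoelder mu (mX l a ml) (mX k (1 - a)%R mk).
move=> /(_ a^-1 (1 - a)^-1)%R; rewrite !aux// !invr_gt0 => /(_ a0 b0).
rewrite !invrK subrKC => /(_ erefl); apply: le_trans.
rewrite Lnorm1 integral_mkcond le_eqVlt; apply/orP; left; apply/eqP.
apply: eq_integral => x _; rewrite patchE /= indicE; case: ifP => _.
  by rewrite !mulr1 ger0_norm// mulr_ge0 ?powR_ge0.
by rewrite !mulr0 normr0.
Qed.

(** The conventions at work: when [f] and [s] both vanish, [0 * +oo = 0] makes the value [+oo]; when
    only [s] vanishes, the value is 0. *)
Lemma inve_abse_ratio (R : realType) (f s : R) : (0 <= s)%R ->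
  `|f%:E * s%:E^-1|^-1 = if f == 0%R then +oo else (s / `|f|)%:E.
Proof.
move=> s0; case: eqVneq => [->|f0]; first by rewrite mul0e abse0 inve0.
have [->|s_neq0] := eqVneq s 0%R.
  by rewrite mul0r inve0 abseM /= gt0_muley ?invey// lte_fin normr_gt0.
rewrite inver (negbTE s_neq0) -EFinM abse_EFin inver normr_eq0 mulf_eq0.
by rewrite invr_eq0 (negbTE f0) (negbTE s_neq0)/= normrM normfV (ger0_norm s0) invfM invrK mulrC.
Qed.

(* The exponents: with [h = f ^ p * s], Hoelder's inequality with weights [a] and
   [1 - a] applied to [bump_factor] and raised to the power [(p + 1) / r] gives
   [(s / f)] to the power [p], as in the harmonic maximal operator, and
   [h ^ q] to the power [q^-1]. *)
Lemma bump_exponents (R : realType) (p r m t j : R) :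
  (0 < p)%R -> (0 < r)%R -> (r < 1)%R -> (0 < m)%R -> (0 < t)%R -> (0 <= j)%R ->
  let a := (p * r / (p + 1))%R in
  let q := (r / (p + 1 - p * r))%R in
  (t `^ p * (m^-1 * ((m / t) `^ a * j `^ (1 - a))) `^ ((p + 1) / r) =
   (m^-1 * j) `^ q^-1)%R.
Proof.
move=> p0 r0 r1 m0 t0 j0 a q.
have d0 : (p + 1 - p * r != 0)%R by rewrite gt_eqF//; nra.
have p10 : (p + 1 != 0)%R by rewrite gt_eqF//; lra.
have rn0 : (r != 0)%R by rewrite gt_eqF.
have ae : (a * ((p + 1) / r) = p)%R by rewrite /a; field; rewrite rn0 p10.
have be : ((1 - a) * ((p + 1) / r) = q^-1)%R.
  by rewrite /a /q; field; rewrite rn0 p10 d0.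
have [mge0 tge0] := (ltW m0, ltW t0).
rewrite (@powRM _ m^-1) ?invr_ge0 ?mulr_ge0 ?powR_ge0//.
rewrite (@powRM _ ((m / t) `^ a)%R) ?powR_ge0// -!powRrM ae be.
rewrite (@powRM _ m^-1 j) ?invr_ge0// (@powRM _ m t^-1) ?invr_ge0//.
rewrite !mulrA; congr (_ * _)%R.
have VX (x y : R) : (0 < x)%R -> (x^-1 `^ y = x `^ (- y))%R.
  by move=> x0; rewrite -(powR_inv1 (ltW x0)) -powRrM mulN1r.
rewrite !VX//.
have -> : (t `^ p * m `^ (- ((p + 1) / r)) * m `^ p * t `^ (- p) =
    (t `^ p * t `^ (- p)) * (m `^ (- ((p + 1) / r)) * m `^ p))%R by ring.
rewrite -!powRD; [|by rewrite ?(gt_eqF t0) ?(gt_eqF m0) implybT..].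
rewrite addrN powRr0 mul1r.
(* The powers of [m] combine because [p - (p + 1) / r = - q^-1]. *)
by congr (_ `^ _)%R; rewrite -be -{2}ae; ring.
Qed.

(** Since [q * (1 - a) = r / (p + 1)], the exponents of [f] cancel and those of [s] add up to
    [r]. *)
Lemma bump_factor (R : realType) (p r s f : R) :
  (0 < p)%R -> (0 < r)%R -> (r < 1)%R -> (0 <= s)%R -> (0 < f)%R ->
  let a := (p * r / (p + 1))%R in
  let q := (r / (p + 1 - p * r))%R in
  (s `^ r = (s / f) `^ a * ((f `^ p * s) `^ q) `^ (1 - a))%R.
Proof.
move=> p0 r0 r1 s0 f0 a q.
have d0 : (p + 1 - p * r != 0)%R by rewrite gt_eqF//; nra.
have p10 : (p + 1 != 0)%R by rewrite gt_eqF//; lra.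
have be : (q * (1 - a) = r / (p + 1))%R by rewrite /q /a; field; rewrite p10 d0.
rewrite -powRrM be powRM ?invr_ge0 ?(ltW f0)// powRM ?powR_ge0//.
rewrite -(powR_inv1 (ltW f0)) -!powRrM mulN1r.
have -> : (s `^ a * f `^ (- a) * (f `^ (p * (r / (p + 1))) * s `^ (r / (p + 1))) =
    (f `^ (- a) * f `^ (p * (r / (p + 1)))) * (s `^ a * s `^ (r / (p + 1))))%R.
  by ring.
rewrite -powRD; last by rewrite (gt_eqF f0) implybT.
(* Here [s] may be 0, so the exponent sum must be nonzero. *)
rewrite -powRD; last by rewrite gt_eqF// addr_gt0 ?divr_gt0 ?mulr_gt0//; lra.
rewrite mulrA addNr powRr0 mul1r; congr (_ `^ _)%R.
by rewrite /a; field; rewrite p10.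
Qed.

(** The condition on [t] bounds the integral of [sigma / |f|] over [B] by [m / t], where [m] is the
    measure of [B]; this controls one Hoelder factor of the integral of [sigma ^ r]. *)
Lemma harmonic_level_estimate (R : realType) (n : nat) (p r C t : R)
    (u sigma f : 'rV[R]_n.+1 -> R) (B : set 'rV[R]_n.+1) :
  let q := (r / (p + 1 - p * r))%R in
  (0 < p)%R -> (0 < r)%R -> (r < 1)%R -> (0 < C)%R -> (0 < t)%R ->
  measurable B -> lebesgue_rV B < +oo ->
  measurable_fun [set: 'rV[R]_n.+1] u -> (forall x, 0 <= u x)%R ->
  measurable_fun [set: 'rV[R]_n.+1] sigma -> (forall x, 0 <= sigma x)%R ->
  measurable_fun [set: 'rV[R]_n.+1] f ->
  average B (fun y => (u y)%:E) <=
    C%:E * average B (fun y => (sigma y `^ r)%:E) `^ ((p + 1) / r) ->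
  t%:E < (average B (fun y => `|(f y)%:E * (sigma y)%:E^-1|^-1))^-1 ->
  (t `^ p)%:E * \int[lebesgue_rV]_(y in B) (u y)%:E <=
    C%:E * (lebesgue_rV B *
      average B (fun y => ((`|f y| `^ p * sigma y) `^ q)%:E) `^ q^-1).
Proof.
move=> q p0 r0 r1 C0 t0 mB Boo mu u0 ms s0 mf bump tB.
set J := \int[lebesgue_rV]_(y in B) ((`|f y| `^ p * sigma y) `^ q)%:E.
have J0 : 0 <= J by apply: integral_ge0 => y _; rewrite lee_fin powR_ge0.
have q0 : (0 < q)%R by rewrite divr_gt0//; nra.
have : 0 <= lebesgue_rV B by exact: measure_ge0.
(* On a null set both sides are 0; otherwise the measure is a positive real [m]. *)
rewrite le_eqVlt => /predU1P[B0|B0].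
  rewrite null_set_integral ?mule0//; last first.
    exact/measurable_funTS/measurable_EFinP.
  by rewrite -B0 mul0e mule0.
move: bump tB; rewrite /average -/J.
move: Boo B0; case: (lebesgue_rV B) => // m _; rewrite lte_fin => m0.
rewrite !inver (gt_eqF m0) => bump tI.
set I := \int[lebesgue_rV]_(y in B) `|(f y)%:E * (sigma y)%:E^-1|^-1.
have gE y : `|(f y)%:E * (sigma y)%:E^-1|^-1 =
    if f y == 0%R then +oo else (sigma y / `|f y|)%:E.
  exact: inve_abse_ratio.
have I0 : 0 <= I by apply: integral_ge0 => y _; rewrite inve_ge0.
have mabsf : measurable_fun [set: 'rV[R]_n.+1] (fun y => `|f y|)%R.
  exact: measurableT_comp.
have mpow (g : 'rV[R]_n.+1 -> R) e : measurable_fun [set: 'rV[R]_n.+1] g ->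
    measurable_fun [set: 'rV[R]_n.+1] (fun y => g y `^ e)%R.
  exact: (measurableT_comp (measurable_powR _)).
have ml : measurable_fun [set: 'rV[R]_n.+1] (fun y => sigma y / `|f y|)%R.
  under eq_fun do rewrite -powR_inv1//.
  by apply: measurable_funM; [exact: ms|exact: mpow].
have mh : measurable_fun [set: 'rV[R]_n.+1] (fun y => `|f y| `^ p * sigma y)%R.
  by apply: measurable_funM; [exact: mpow|exact: ms].
have l0 y : (0 <= sigma y / `|f y|)%R by rewrite divr_ge0.
have mg : measurable_fun [set: 'rV[R]_n.+1]
    (fun y => `|(f y)%:E * (sigma y)%:E^-1|^-1).
  under eq_fun do rewrite gE.
  apply: measurable_fun_ifT.
  - by apply: measurable_fun_eqr; [exact: mf|exact: measurable_cst].
  - exact: measurable_cst.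
  - exact/measurable_EFinP.
have Imt : I <= (m / t)%:E.
  have : (m^-1)%:E * I < t%:E^-1.
    rewrite -inve_pgt// inE/=; first by rewrite lee_fin ltW.
    by rewrite mule_ge0// lee_fin invr_ge0 ltW.
  rewrite inver gt_eqF// => /ltW.
  by rewrite lee_pdivrMl// -EFinM.
have Ifin : I < +oo by apply: le_lt_trans Imt (ltry _).
set a := (p * r / (p + 1))%R.
have a01 : (0 < a < 1)%R.
  by rewrite divr_gt0 ?mulr_gt0 ?ltr_pdivrMr ?addr_gt0//; nra.
have a1 : (1 - a != 0)%R by rewrite subr_eq0 gt_eqF//; case/andP: a01.
(* The factorization needs [f y != 0]. This holds almost everywhere on [B], as the integrand of [I]
   is [+oo] at zeros of [f] while [I] is finite. *)
have SE : \int[lebesgue_rV]_(y in B) (sigma y `^ r)%:E =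
   \int[lebesgue_rV]_(y in B) ((sigma y / `|f y|) `^ a *
     ((`|f y| `^ p * sigma y) `^ q) `^ (1 - a))%:E.
  apply: ge0_ae_eq_integral.
  - exact: mB.
  - by apply/measurable_funTS/measurable_EFinP; exact: mpow.
  - apply/measurable_funTS/measurable_EFinP; apply: measurable_funM.
      exact: mpow.
    exact/mpow/mpow.
  - by move=> y _; rewrite lee_fin powR_ge0.
  - by move=> y _; rewrite lee_fin mulr_ge0 ?powR_ge0.
  have : lebesgue_rV.-integrable B (fun y => `|(f y)%:E * (sigma y)%:E^-1|^-1).
    apply/integrableP; split; first exact: measurable_funTS.
    rewrite (eq_integral (fun y => `|(f y)%:E * (sigma y)%:E^-1|^-1))// => y _.
    by rewrite gee0_abs// inve_ge0.
  move=> /(integrable_ae mB); apply: filterS => y /[swap] By /(_ By).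
  rewrite gE; case: eqVneq => // f0 _; congr EFin.
  by apply: bump_factor; rewrite ?normr_gt0.
have SJ : \int[lebesgue_rV]_(y in B) (sigma y `^ r)%:E <=
    (m / t)%:E `^ a * J `^ (1 - a).
  rewrite SE; have := hoelder_powR lebesgue_rV mB ml (mpow _ q mh) l0 _ a01.
  move=> /(_ (fun=> powR_ge0 _ _))/le_trans; apply.
  apply: lee_wpmul2r; first exact: poweR_ge0.
  apply: gt0_ler_poweR; rewrite ?in_itv/= ?leey ?andbT ?lee_fin.
  - by case/andP: a01 => /ltW.
  - by apply: integral_ge0 => y _; rewrite lee_fin.
  - by rewrite divr_ge0// ltW.
  apply: le_trans Imt; apply: ge0_le_integral.
  - exact: mB.
  - by move=> y _; rewrite lee_fin.
  - exact/measurable_funTS/measurable_EFinP.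
  - exact: measurable_funTS.
  - by move=> y _; rewrite gE; case: eqP => // _; rewrite leey.
move: J0 SJ; case: J => [j|_ _|//]; last first.
  rewrite gt0_muley ?lte_fin ?invr_gt0//.
  rewrite poweRyr ?invr_neq0 ?gt_eqF// !gt0_muley ?lte_fin// leey//.
rewrite lee_fin => j0; rewrite !poweR_EFin -EFinM => SJ.
have m1 : (0 <= m^-1)%R by rewrite invr_ge0 ltW.
have e0 : (0 <= (p + 1) / r)%R by rewrite divr_ge0 ?addr_ge0// ltW.
have : (m^-1)%:E * \int[lebesgue_rV]_(y in B) (u y)%:E <=
    C%:E * ((m^-1)%:E * ((m / t) `^ a * j `^ (1 - a))%:E) `^ ((p + 1) / r).
  apply: (le_trans bump); apply: lee_wpmul2l; first by rewrite lee_fin ltW.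
  apply: gt0_ler_poweR; rewrite ?in_itv/= ?leey ?andbT ?lee_fin//.
  - by rewrite mule_ge0 ?lee_fin// integral_ge0// => y _; rewrite lee_fin powR_ge0.
  - by rewrite mulr_ge0// mulr_ge0 ?powR_ge0.
  - by apply: lee_wpmul2l; rewrite ?lee_fin.
rewrite lee_pdivrMl//.
move=> /(lee_wpmul2l (x := (t `^ p)%:E)).
rewrite lee_fin powR_ge0 => /(_ isT)/le_trans; apply.
rewrite -!EFinM lee_fin -(bump_exponents p0 r0 r1 m0 t0 j0).
by rewrite le_eqVlt; apply/orP; left; apply/eqP; rewrite -/a; ring.
Qed.

(** * Finiteness, Fatou's lemma and the power form of the maximal bound *)

(** A single cube covers [B]; the remaining boxes of the sequence are points, of volume 0. *)
Lemma lebesgue_rV_bounded (R : realType) (n : nat) (B : set 'rV[R]_n.+1) :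
  bounded_set B -> lebesgue_rV B < +oo.
Proof.
move=> [M [_ /(_ (M + 1)%R)]]; rewrite ltrDl => /(_ ltr01) BM.
pose F (k : nat) : 'rV[R]_n.+1 * 'rV[R]_n.+1 :=
  if k == 0%N then (const_mx (- (M + 1))%R, const_mx (M + 1)%R) else (0%R, 0%R).
apply: (@le_lt_trans _ _ (\sum_(k <oo) (box_volume (F k).1 (F k).2)%:E)).
  apply: ereal_inf_lbound; exists F => // x Bx; exists 0%N => // i /=.
  rewrite !mxE -ler_norml; apply: le_trans (BM _ Bx).
  rewrite [leRHS]mx_normrE.
  by have := le_bigmax 0%R (fun ij : 'I_1 * 'I_n.+1 => `|x ij.1 ij.2|%R) (ord0, i).
rewrite (@nneseries_split _ _ 0%N 1%N); last first.
  by move=> k _; rewrite lee_fin box_volume_ge0.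
rewrite eseries0 ?adde0 ?big_nat1 ?ltry// => k /= k0 _.
by rewrite /F gtn_eqF// /box_volume big_ord_recl mxE subr0 maxxx mul0r.
Qed.

(** The pointwise hypothesis expresses [F <= liminf G k] through real thresholds [z], which also
    handles points where [F] is infinite. *)
Lemma fatou_le d (T : measurableType d) (R : realType)
    (mu : {measure set T -> \bar R}) (F : T -> \bar R) (G : nat -> T -> \bar R)
    (L : \bar R) :
  measurable_fun setT F -> (forall x, 0 <= F x) ->
  (forall k, measurable_fun setT (G k)) -> (forall k x, 0 <= G k x) ->
  (forall x z, z%:E < F x -> exists N, forall k, (N <= k)%N -> z%:E <= G k x) ->
  (forall k, \int[mu]_x G k x <= L) -> \int[mu]_x F x <= L.
Proof.
move=> mF F0 mG G0 FG GL.
have einfE (w : nat -> \bar R) : limn_einf w = ereal_sup (range (einfs w)).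
  by rewrite limn_einf_lim; apply/cvg_lim => //; exact: cvg_einfs_sup.
apply: (@le_trans _ _ (\int[mu]_x limn_einf (G^~ x))).
  apply: ge0_le_integral => //.
    apply: measurableT_comp => //; apply: measurable_fun_limn_esup => k.
    exact: measurableT_comp.
  move=> x _; rewrite leNgt; apply/negP => GF.
  have [z [Gz zF]] : exists z, limn_einf (G^~ x) < z%:E /\ z%:E < F x.
    move: (F0 x) GF; case: (F x) => [y _|_|//]; case: limn_einf => [w|//|].
    - by rewrite lte_fin => wy; exists ((w + y) / 2)%R; rewrite !lte_fin !midf_lt.
    - by exists (y - 1)%R; rewrite ltNyr lte_fin gtrBl.
    - by exists (w + 1)%R; rewrite lte_fin ltry ltrDl.
    - by exists 0%R; rewrite ltNyr ltry.
  have [N HN] := FG _ _ zF; move: Gz; rewrite ltNge => /negP; apply.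
  rewrite einfE; apply: le_trans (ereal_sup_ubound _); last by exists N.
  by apply: le_ereal_inf_tmp => _ [k /= Nk <-]; exact: HN.
apply: (le_trans (fatou _ _ _ _)) => //.
rewrite einfE; apply: ge_ereal_sup => _ [k _ <-].
by apply: le_trans (GL k); apply: ereal_inf_lbound; exists k => /=.
Qed.

(** Boundedness on [L^s] is applied to [h ^ (1/s)], and the norms are raised to the power [s]. *)
Lemma hl_maximal_powR (R : realType) (n : nat) (Bs : set (set 'rV[R]_n.+1))
    (s : R) : (1 < s)%R -> hl_maximal_bounded Bs s ->
  exists2 C : R, (0 <= C)%R & forall h : 'rV[R]_n.+1 -> R,
    measurable_fun [set: 'rV[R]_n.+1] h -> (forall x, 0 <= h x)%R ->
    \int[lebesgue_rV]_x (h x)%:E < +oo ->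
    \int[lebesgue_rV]_x hl_maximal Bs (fun y => (h y `^ s^-1)%:E) x `^ s <=
      C%:E * \int[lebesgue_rV]_x (h x)%:E.
Proof.
(* The given [C] may be negative; the absolute value allows the power of the product to split. *)
move=> s1 [C CP]; exists (`|C| `^ s)%R; first exact: powR_ge0.
move=> h mh h0 hoo; have s0 : (0 < s)%R by rewrite (lt_trans _ s1).
have sn0 : s != 0%R by rewrite gt_eqF.
pose k x := (h x `^ s^-1)%R.
have kE : 'N[@lebesgue_rV R n]_s%:E[EFin \o k] `^ s = \int[lebesgue_rV]_x (h x)%:E.
  rewrite poweR_Lnorm//; apply: eq_integral => x _ /=.
  by rewrite ger0_norm ?powR_ge0// -powRrM mulVf// powRr1.
have kL : k \in Lfun (@lebesgue_rV R n) s%:E.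
  apply/andP; split; rewrite inE /=.
    exact: (measurableT_comp (measurable_powR _)).
  by rewrite /finite_norm (lty_poweRy sn0)// kE.
have : 'N[lebesgue_rV]_s%:E[hl_maximal Bs (EFin \o k)] `^ s <=
    (`|C|%:E * 'N[lebesgue_rV]_s%:E[EFin \o k]) `^ s.
  apply: (gt0_ler_poweR (ltW s0)); rewrite ?in_itv/= ?leey ?andbT ?Lnorm_ge0//.
    by rewrite mule_ge0 ?Lnorm_ge0.
  apply: (le_trans (CP k kL)); apply: lee_wpmul2r; first exact: Lnorm_ge0.
  by rewrite lee_fin ler_norm.
rewrite poweRM ?lee_fin ?Lnorm_ge0// kE poweR_Lnorm// poweR_EFin.
apply: le_trans; rewrite le_eqVlt; apply/orP; left; apply/eqP.
apply: eq_integral => x _; rewrite gee0_abs//.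
exact: (basis_sup_ge0 Bs (fun B => average B _)).
Qed.

(** * Condition A and the bound by the Hardy-Littlewood operator *)

(** With [S] the union of the kept sets, the average of [1_S] over a discarded set exceeds [alpha],
    so that set lies where the maximal function of [1_S] exceeds [alpha]. The 1 in the constant
    accounts for [S] itself. *)
Lemma weight_select_cover (R : realType) (n : nat) (Bs : set (set 'rV[R]_n.+1))
    (u : 'rV[R]_n.+1 -> R) (B : nat -> set 'rV[R]_n.+1) (alpha c : R) l :
  is_basis Bs -> measurable_fun [set: 'rV[R]_n.+1] u -> (forall x, 0 <= u x)%R ->
  (forall k, B k = set0 \/ Bs (B k)) ->
  (forall E : set 'rV[R]_n.+1, measurable E ->
     weight_mass u [set x | alpha%:E < hl_maximal Bs (EFin \o \1_E) x] <=
       c%:E * weight_mass u E) ->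
  \int[lebesgue_rV]_(x in \big[setU/set0]_(k <- l) B k) (u x)%:E <=
    (1 + `|c|)%:E *
    \int[lebesgue_rV]_(x in
      \big[setU/set0]_(k <- select lebesgue_rV B alpha l) B k) (u x)%:E.
Proof.
move=> basis mu u0 BP condA.
have mB k : measurable (B k).
  by have [->//|/basis[+ _]] := BP k; exact: measurable_open_rV.
set S := \big[setU/set0]_(k <- select _ _ _ _) B k.
have mS : measurable S by exact: measurable_bigcup_seq.
have mU : measurable (\big[setU/set0]_(k <- l) B k) by exact: measurable_bigcup_seq.
set M := [set x | alpha%:E < hl_maximal Bs (EFin \o \1_S) x].
have mM : measurable M.
  rewrite -[M]setTI; apply: emeasurable_fun_o_infty => //.
  exact: (measurable_basis_sup (fun B => average B _)).
have int0 A : 0 <= \int[lebesgue_rV]_(x in A) (u x)%:E.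
  by apply: integral_ge0 => x _; rewrite lee_fin.
have mu' : measurable_fun [set: 'rV[R]_n.+1] (EFin \o u) by exact/measurable_EFinP.
apply: (@le_trans _ _ (\int[lebesgue_rV]_(x in S `|` M) (u x)%:E)).
  apply: ge0_subset_integral => //.
  - exact: measurableU.
  - exact: measurable_funTS.
  - by move=> x _; rewrite lee_fin.
  move=> x /(@select_cover _ _ _ lebesgue_rV B alpha mB l)[|[k [kx hk]]].
    by left.
  right; rewrite /M /=.
  have [k0|Bk] := BP k; first by rewrite k0 in kx.
  apply: (lt_le_trans _ (@le_basis_sup _ _ _ (fun B => average B _) _ _ Bk kx)).
  rewrite /average.
  under eq_integral do rewrite /= ger0_norm//.
  rewrite integral_indic// setIC.
  have : lebesgue_rV (B k) < +oo.
    by apply: lebesgue_rV_bounded; exact: (basis _ Bk).2.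
  have : lebesgue_rV (B k `&` S) <= lebesgue_rV (B k).
    by apply: le_measure; rewrite ?inE//; exact: measurableI.
  have : alpha%:E * lebesgue_rV (B k) < lebesgue_rV (B k `&` S) by exact: hk.
  have : 0 <= lebesgue_rV (B k) by exact: measure_ge0.
  (* Dividing by the measure of [B k] needs it positive: at measure 0 the strict overlap bound would
     read [0 < 0]. *)
  case: (lebesgue_rV (B k)) => [m| |]//; rewrite lee_fin le_eqVlt.
  move=> /predU1P[<-|m0]; first by move=> /lt_le_trans/[apply]; rewrite -EFinM mulr0 ltxx.
  by move=> akS _ _; rewrite inver gt_eqF// lte_pdivlMl// muleC; exact: akS.
have u0' y : 0 <= (EFin \o u) y by rewrite lee_fin.
apply: (le_trans (ge0_integral_setU_le lebesgue_rV mS mM mu' u0')).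
rewrite EFinD ge0_muleDl ?lee_fin// mul1e; apply: leeD => //.
apply: (le_trans (condA _ mS)); apply: lee_wpmul2r; first exact: int0.
by rewrite lee_fin ler_norm.
Qed.

(** On [E] the maximal function is at least the average over [B], and [E] has at least the fraction
    [1 - alpha] of the measure of [B]. *)
Lemma average_le_integral_maximal (R : realType) (n : nat)
    (Bs : set (set 'rV[R]_n.+1)) (k : 'rV[R]_n.+1 -> \bar R) (alpha C s : R)
    (B E : set 'rV[R]_n.+1) :
  is_basis Bs -> Bs B -> measurable E -> E `<=` B -> (forall x, 0 <= k x) ->
  (alpha < 1)%R -> (0 <= C)%R -> (0 <= s)%R ->
  lebesgue_rV (B `\` E) <= alpha%:E * lebesgue_rV B ->
  C%:E * (lebesgue_rV B * average B k `^ s) <=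
    \int[lebesgue_rV]_(x in E) ((C / (1 - alpha))%:E * hl_maximal Bs k x `^ s).
Proof.
move=> basis BsB mE EB k0 a1 C0 s0 BE.
have mB : measurable B by apply: measurable_open_rV; exact: (basis _ BsB).1.
have a1' : (0 < 1 - alpha)%R by rewrite subr_gt0.
have kE : average B (fun y => `|k y|) = average B k.
  by congr (_ * _); apply: eq_integral => y _; rewrite gee0_abs.
have A0 : 0 <= average B k.
  by rewrite mule_ge0 ?inve_ge0 ?integral_ge0//; exact: measure_ge0.
have Cs x : 0 <= (C / (1 - alpha))%:E * x `^ s.
  by rewrite mule_ge0 ?poweR_ge0// lee_fin divr_ge0// ltW.
apply: (@le_trans _ _ (\int[lebesgue_rV]_(x in E)
    (cst ((C / (1 - alpha))%:E * average B k `^ s)) x)); last first.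
  apply: ge0_le_integral.
  - exact: mE.
  - by move=> x _; exact: Cs.
  - exact: measurable_cst.
  - apply: measurable_funTS; apply: measurable_funeM.
    apply: (measurableT_comp (measurable_poweR _)).
    exact: (measurable_basis_sup (fun B => average B _)).
  - move=> x Ex; apply: lee_wpmul2l; first by rewrite lee_fin divr_ge0// ltW.
    apply: gt0_ler_poweR; rewrite ?in_itv/= ?leey ?andbT//.
      exact: (basis_sup_ge0 Bs (fun B => average B _)).
    rewrite -kE; apply: (@le_basis_sup _ _ _ (fun B => average B _)) => //.
    exact: EB.
rewrite integral_cst// EFinM -!muleA; apply: lee_wpmul2l; first by rewrite lee_fin.
rewrite muleCA muleC; apply: lee_wpmul2l; first exact: poweR_ge0.
have Boo : lebesgue_rV B < +oo by apply: lebesgue_rV_bounded; exact: (basis _ BsB).2.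
suff : lebesgue_rV B <= ((1 - alpha)^-1)%:E * lebesgue_rV E by [].
have : lebesgue_rV B <= lebesgue_rV (B `\` E) + lebesgue_rV E.
  rewrite -[in leLHS](setDUK EB) setUC.
  by apply: measureU2 => //; exact: measurableD.
move: BE (measure_ge0 (@lebesgue_rV R n) E : 0 <= lebesgue_rV E).
have : 0 <= lebesgue_rV (B `\` E) by exact: measure_ge0.
have : 0 <= lebesgue_rV B by exact: measure_ge0.
move: Boo; case: (lebesgue_rV B) => [b| |]// _ _.
case: (lebesgue_rV (B `\` E)) => [d| |]// _ db.
case: (lebesgue_rV E) => [e| |]// _; last first.
  by rewrite gt0_muley ?leey// lte_fin invr_gt0.
rewrite -EFinM -EFinD !lee_fin in db * => bde.
by rewrite ler_pdivlMl//; lra.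
Qed.

(** This joins the covering argument to the level estimate before any boundedness of the maximal
    operator enters; the right side may be infinite. *)
Lemma harmonic_maximal_le (R : realType) (n : nat) (p r C alpha c : R)
    (u sigma f : 'rV[R]_n.+1 -> R) (Bs : set (set 'rV[R]_n.+1)) :
  let q := (r / (p + 1 - p * r))%R in
  is_basis Bs -> (0 < p)%R -> (0 < r)%R -> (r < 1)%R -> (0 < C)%R ->
  (alpha < 1)%R ->
  measurable_fun [set: 'rV[R]_n.+1] u -> (forall x, 0 <= u x)%R ->
  measurable_fun [set: 'rV[R]_n.+1] sigma -> (forall x, 0 <= sigma x)%R ->
  measurable_fun [set: 'rV[R]_n.+1] f ->
  (forall E : set 'rV[R]_n.+1, measurable E ->
     weight_mass u [set x | alpha%:E < hl_maximal Bs (EFin \o \1_E) x] <=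
       c%:E * weight_mass u E) ->
  (forall B : set 'rV[R]_n.+1, Bs B ->
     average B (fun y => (u y)%:E) <=
       C%:E * average B (fun y => (sigma y `^ r)%:E) `^ ((p + 1) / r)) ->
  \int[lebesgue_rV]_x
     (harmonic_maximal Bs (fun y => (f y)%:E * (sigma y)%:E^-1) x `^ p
      * (u x)%:E) <=
    (1 + `|c|)%:E * \int[lebesgue_rV]_x ((C / (1 - alpha))%:E *
      hl_maximal Bs (fun y => ((`|f y| `^ p * sigma y) `^ q)%:E) x `^ q^-1).
Proof.
move=> q basis p0 r0 r1 C0 alpha1 mu u0 ms s0 mf condA bump.
have q0 : (0 < q)%R by rewrite divr_gt0//; nra.
pose phi B := (average B (fun y => `|(f y)%:E * (sigma y)%:E^-1|^-1))^-1.
have [t [B [tB tBx]]] := basis_sup_countable phi basis.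
have BP k : B k = set0 \/ Bs (B k) by have [_ [|[]]] := tB k; tauto.
have mB k : measurable (B k).
  by have [->//|/basis[+ _]] := BP k; exact: measurable_open_rV.
pose a k := (t k `^ p)%R.
have a0 k : (0 <= a k)%R by exact: powR_ge0.
set H := (X in _ <= _ * \int[_]_x X x).
have H0 x : 0 <= H x.
  by rewrite /H mule_ge0 ?poweR_ge0// lee_fin divr_ge0 ?subr_ge0// ltW.
have mH : measurable_fun [set: 'rV[R]_n.+1] H.
  apply: measurable_funeM; apply: (measurableT_comp (measurable_poweR _)).
  exact: (measurable_basis_sup (fun B => average B _)).
(* The first [N] pairs by increasing level, so that [select], working from the end, treats the
   highest levels first. *)
pose l N := sort (relpre a <=%R) (iota 0 N).
have l_sorted N : sorted (relpre a <=%R) (l N).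
  by apply: sort_sorted => i j; exact: le_total.
have al N : all (fun k => 0 <= a k)%R (l N) by apply/allP => k _.
have lev0 N x : (0 <= levels B a 0 (l N) x)%R by exact: levels_ge0.
have mlev N : measurable_fun [set: 'rV[R]_n.+1] (levels B a 0 (l N)).
  exact: measurable_levels.
have M0 x : 0 <= basis_sup Bs phi x by exact: basis_sup_ge0.
apply: (@fatou_le _ _ _ _ _ (fun N x => (levels B a 0 (l N) x * u x)%:E)).
- apply: emeasurable_funM; last exact/measurable_EFinP.
  apply: (measurableT_comp (measurable_poweR _)).
  exact: (measurable_basis_sup phi basis).
- by move=> x; rewrite mule_ge0 ?poweR_ge0 ?lee_fin.
- by move=> N; apply/measurable_EFinP; apply: measurable_funM.
- by move=> N x; rewrite lee_fin mulr_ge0.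
- move=> x z zM.
  have [z0|z0] := leP z 0%R.
    by exists 0%N => k _; rewrite lee_fin (le_trans z0)// mulr_ge0.
  have ux0 : (0 < u x)%R.
    rewrite lt_neqAle u0 andbT; apply/eqP => ux0; move: zM.
    by rewrite -ux0 mule0 lte_fin ltNge ltW.
  have zu0 : (0 <= z / u x)%R by rewrite divr_ge0// ltW.
  (* This threshold is the value of the maximal function at which its [p]-th power times [u x]
     equals [z]; [u x > 0] follows from [z > 0]. *)
  have [|k [stk kx]] := tBx x ((z / u x) `^ p^-1)%R (powR_ge0 _ _).
    rewrite ltNge; apply/negP => Ms; move: zM; rewrite ltNge => /negP; apply.
    rewrite -lee_pdivlMr// -EFinM.
    apply: (@le_trans _ _ (((z / u x) `^ p^-1)%:E `^ p)).
      apply: (gt0_ler_poweR (ltW p0)) => //; rewrite in_itv/= leey andbT.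
        exact: M0.
      by rewrite lee_fin powR_ge0.
    by rewrite poweR_EFin -powRrM mulVf ?gt_eqF// powRr1.
  (* Once [N > k] the index [k] belongs to [l N], and its level alone exceeds [z / u x]. *)
  exists k.+1 => N kN; rewrite lee_fin -ler_pdivrMr//.
  apply: (@le_trans _ _ (a k - 0)%R); last first.
    by apply: le_levels => //; rewrite mem_sort mem_iota.
  rewrite subr0 -[leLHS]powRr1// -[X in (_ `^ X)%R](@mulVf _ p) ?gt_eqF// powRrM.
  by apply: ge0_ler_powR; rewrite ?nnegrE ?powR_ge0// ltW// (tB k).1.
move=> N.
have cov l' := @weight_select_cover R n Bs u B alpha c l' basis mu u0
  BP condA.
have c0 : (0 <= 1 + `|c|)%R by rewrite addr_ge0.
have := integral_levels mB mu u0 c0 cov (al N) (l_sorted N).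
move=> /le_trans; apply.
apply: lee_wpmul2l; first by rewrite lee_fin addr_ge0.
(* The sum over kept sets is compared with the integral of [H] over their union, which is then
   enlarged to the whole space. *)
apply: (@le_trans _ _ (\int[lebesgue_rV]_(x in
    \big[setU/set0]_(k <- select lebesgue_rV B alpha (l N)) B k) H x)); last first.
  by apply: ge0_subset_integral => //; exact: measurable_bigcup_seq.
apply: select_integral => // k E mE EB BE.
rewrite subr0.
have [t0 [k0|[BsB tphi]]] := tB k.
  by rewrite k0 integral_set0 mule0 integral_ge0.
have [oB bB] := basis _ BsB.
apply: (le_trans (harmonic_level_estimate p0 r0 r1 C0 t0 (mB k)
  (lebesgue_rV_bounded bB) mu u0 ms s0 mf (bump _ BsB) tphi)).
apply: average_le_integral_maximal => //.
- by move=> x; rewrite lee_fin powR_ge0.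
- exact: ltW.
- by rewrite invr_ge0 ltW.
Qed.

(** * Choice of the constants and conclusion *)

Theorem theorem2p4 (R : realType) (n : nat) (p : R)
  (u sigma : 'rV[R]_n.+1 -> R) (Bs : set (set 'rV[R]_n.+1))
  (p_gt0 : (0 < p)%R)
  (weight_u : is_weight u) (weight_sigma : is_weight sigma)
  (basis_Bs : is_basis Bs)
  (hl_bounded : forall s : R, (1 < s)%R -> hl_maximal_bounded Bs s)
  (condA_u : condition_A Bs u)
  (bump : exists r C : R, [/\ (0 < r)%R, (r < 1)%R &
     forall B : set 'rV[R]_n.+1, Bs B ->
       average B (fun y => (u y)%:E) <=
         C%:E * average B (fun y => (sigma y `^ r)%:E) `^ ((p + 1) / r)]) :
  exists C' : R, forall f : 'rV[R]_n.+1 -> R, weighted_Lp p sigma f ->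
    \int[lebesgue_rV]_x
       (harmonic_maximal Bs (fun y => (f y)%:E * (sigma y)%:E^-1) x `^ p
        * (u x)%:E) <=
      C'%:E * \int[lebesgue_rV]_x (`|f x| `^ p * sigma x)%:E.
Proof.
have [alpha [c [alpha0 alpha1 condA]]] := condA_u.
have [r [C [r0 r1 bumpC]]] := bump.
have [u0 [mu _]] := weight_u; have [s0 [ms _]] := weight_sigma.
have q0 : (0 < r / (p + 1 - p * r))%R by rewrite divr_gt0//; nra.
(* This is [r * (p + 1) < p + 1], that is [r < 1]; it makes [q^-1] an admissible exponent for the
   maximal operator. *)
have q1 : (1 < (r / (p + 1 - p * r))^-1)%R.
  by rewrite invf_gt1// ltr_pdivrMr; nra.
have [D D0 DP] := hl_maximal_powR q1 (hl_bounded _ q1).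
(* The bump constant has no assumed sign, so it is enlarged to a positive one. *)
have C0 : (0 < `|C| + 1)%R by rewrite ltr_wpDl.
have bumpC' B : Bs B -> average B (fun y => (u y)%:E) <=
    (`|C| + 1)%:E * average B (fun y => (sigma y `^ r)%:E) `^ ((p + 1) / r).
  move=> BsB; apply: (le_trans (bumpC _ BsB)); apply: lee_wpmul2r.
    exact: poweR_ge0.
  by rewrite lee_fin (le_trans (ler_norm _))// lerDl.
(* The factors come from condition A, from the bump condition together with the size of the new
   parts, and from the maximal bound on [L^(1/q)]. *)
exists ((1 + `|c|) * ((`|C| + 1) / (1 - alpha) * D))%R => f [mf foo].
apply: (le_trans (harmonic_maximal_le basis_Bs p_gt0 r0 r1 C0 alpha1
  mu u0 ms s0 mf condA bumpC')).
rewrite [X in _ <= X * _]EFinM -muleA; apply: lee_wpmul2l; first by rewrite lee_fin addr_ge0.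
rewrite ge0_integralZl; first last.
- by rewrite lee_fin divr_ge0 ?subr_ge0// ltW.
- by move=> x _; exact: poweR_ge0.
- apply: (measurableT_comp (measurable_poweR _)).
  exact: (measurable_basis_sup (fun B => average B _)).
- exact: measurableT.
rewrite [X in _ <= X * _]EFinM -muleA; apply: lee_wpmul2l.
  by rewrite lee_fin divr_ge0 ?subr_ge0// ltW.
have := DP (fun y => `|f y| `^ p * sigma y)%R; rewrite invrK; apply.
- apply: measurable_funM; last exact: ms.
  apply: (measurableT_comp (measurable_powR _)).
  exact: measurableT_comp.
- by move=> x; rewrite mulr_ge0 ?powR_ge0.
- exact: foo.
Qed.
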